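(* The following equalities hold: (1) $\mathsf{\Delta}(\mathbb E_{\omega_1})=\mathsf{\Delta}(\mathbb E_{\omega_1}^\circ)=\mathsf{\Sigma}(\mathbb E_{\omega_1})=\mathsf{\Sigma}(\mathbb E_{\omega_1}^\circ)=\mathfrak b$. (2) $\mathsf{\Lambda}(\mathbb E_{\omega_1})=\mathsf{\Lambda}(\mathbb E_{\omega_1}^\circ)=\mathfrak d$. (3) $\mathsf{\Lambda}(\mathbb E_\kappa)=\mathsf{\Lambda}(\mathbb E_\kappa^\circ)=\mathfrak c$ for every cardinal $\kappa\in[2,\omega]$. (4) $\mathsf{\Delta}(\mathbb E_\kappa)=\mathsf{\Delta}(\mathbb E_\kappa^\circ)=\mathsf{\Delta}$ for every cardinal $\kappa\in[2,\omega]$. (5) $\mathsf{\Sigma}(\mathbb E_\kappa)=\mathsf{\Sigma}(\mathbb E_\kappa^\circ)=\mathsf{\Sigma}$ for every cardinal $\kappa\in[2,\omega]$.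
   Context: An entourage on $\omega$ is a set $E\subseteq\omega\times\omega$ containing the diagonal; $E^{-1}=\{(y,x):(x,y)\in E\}$, $E(x)=\{y:(x,y)\in E\}$, $E[A]=\bigcup_{a\in A}E(a)$. An entourage is cellular if it is an equivalence relation. For finite $n\ge2$, $\mathbb E_n$ is the set of entourages $E$ on $\omega$ with $|E(x)|\le n$ and $|E^{-1}(x)|\le n$ for all $x$; $\mathbb E_\omega$ is the set of finitary entourages, i.e. those with $\sup_{x\in\omega}\max\{|E(x)|,|E^{-1}(x)|\}<\omega$; $\mathbb E_{\omega_1}$ is the set of locally finite entourages, i.e. those with $E(x)\cup E^{-1}(x)$ finite for every $x$. $\mathbb E_\kappa^\circ$ is the set of cellular members of $\mathbb E_\kappa$. $[\omega]^\omega$ is the family of infinite subsets of $\omega$. A family $\mathcal E$ of entourages on $\omega$ is large if for every $L\in[\omega]^\omega$ there is $E\in\mathcal E$ with $E[L]=\omega$ (all the families $\mathbb E_\kappa$, $\mathbb E_\kappa^\circ$ above are large). For a large family $\mathcal E$ put $$\mathsf{\Delta}(\mathcal E)=\min\{|\mathcal E'|:\mathcal E'\subseteq\mathcal E\wedge\forall D\in[\omega]^\omega\ \exists E\in\mathcal E'\ \{x\in D:D\cap E(x)\ne\{x\}\}\in[\omega]^\omega\},$$ $$\mathsf{\Sigma}(\mathcal E)=\min\{|\mathcal E'|:\mathcal E'\subseteq\mathcal E\wedge\forall A,B\in[\omega]^\omega\ \exists E\in\mathcal E'\ E[A]\cap E[B]\in[\omega]^\omega\},$$ $$\mathsf{\Lambda}(\mathcal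 E)=\min\{|\mathcal E'|:\mathcal E'\subseteq\mathcal E\wedge\forall L\in[\omega]^\omega\ \exists E\in\mathcal E'\ E[L]=\omega\}.$$ With $S_\omega$ the group of bijections of $\omega$, the cardinals $\mathsf{\Delta},\mathsf{\Sigma}$ (without argument) are $$\mathsf{\Delta}=\min\{|H|:H\subseteq S_\omega\wedge\forall A\in[\omega]^\omega\ \exists h\in H\ \{a\in A:a\ne h(a)\in A\}\in[\omega]^\omega\},$$ $$\mathsf{\Sigma}=\min\{|H|:H\subseteq S_\omega\wedge\forall A,B\in[\omega]^\omega\ \exists h\in H\ h[A]\cap B\in[\omega]^\omega\}.$$ $\mathfrak b$ is the smallest cardinality of a subset of $\omega^\omega$ unbounded with respect to $\le^*$ (eventual domination), $\mathfrak d$ is the smallest cardinality of a dominating subset of $(\omega^\omega,\le^* )$, and $\mathfrak c=2^{\aleph_0}$. *)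

(* Defs.v *)
From mathcomp Require Import all_boot.
From mathcomp Require Import boolp classical_sets functions cardinality filter.
From Stdlib Require Import RelationClasses.

Set Implicit Arguments.
Unset Strict Implicit.
Unset Printing Implicit Defensive.

Local Open Scope classical_set_scope.
Local Open Scope card_scope.
Local Open Scope relation_scope.

(* Cardinals are Frege cardinals (classes of equipotent types), so that
   cardinalities of subsets of different types can be equated with [=]. *)
Definition cardinal := set Type.

Definition card_of (T : Type) (A : set T) : cardinal :=
  [set X : Type | [set: X] #= A].

(* min {|A| : P A}; the minimum is attained as soon as P is nonempty, see
   [mincard_attained] and [mincardE] below. *)
Definition mincard (T : Type) (P : set (set T)) : cardinal :=
  \bigcup_(A in [set A | P A /\ forall B, P B -> A #<= B]) card_of A.

Lemma mincard_attained (T : Type) (P : set (set T)) :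
  P !=set0 -> exists2 A, P A & forall B, P B -> A #<= B.
Proof.
move=> [A0 PA0].
pose thr := [set F : set (set T -> T) |
  (forall f, F f -> forall A, P A -> A (f A)) /\
  (forall A, P A -> set_inj F (fun f => f A))].
have [|F [[Fin Finj] Fmax]] := @Zorn_bigcup _ thr.
  move=> C Cthr Ctot; split => [f [F CF Ff]|A PA f g].
    by have [+ _] := Cthr _ CF; apply.
  move=> /set_mem[F CF Ff] /set_mem[G CG Gg].
  have [FG|GF] := Ctot _ _ CF CG.
  - have [_ /(_ _ PA) inj] := Cthr _ CG.
    by apply: inj; apply: mem_set => //; exact: FG.
  - have [_ /(_ _ PA) inj] := Cthr _ CF.
    by apply: inj; apply: mem_set => //; exact: GF.
have [[A PA AF]|noA] := pselect (exists2 A, P A & A `<=` (fun f => f A) @` F).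
  exists A => // B PB.
  apply: (card_le_trans (subset_card_le AF)).
  apply: (card_le_trans (card_image_le _ _)).
  rewrite -(card_le_eql (inj_card_eq (Finj _ PB))).
  by apply: subset_card_le => _ [f Ff <-]; apply: (Fin _ Ff).
have new A : P A -> exists2 a, A a & forall f, F f -> f A <> a.
  move=> PA; apply: contrapT => h; apply: noA; exists A => // a Aa.
  apply: contrapT => nFa; apply: h; exists a => // f Ff fa.
  by apply: nFa; exists f.
have [t _ _] := new _ PA0.
have /choice[g gP] A : exists a, P A -> A a /\ forall f, F f -> f A <> a.
  have [PA|nPA] := pselect (P A); last by exists t => /nPA.
  by have [a Aa aP] := new _ PA; exists a.
exfalso; apply: (Fmax (F `|` [set g])).
  split; first by move=> f Ff; left.
  move=> /(_ g (or_intror erefl)) Fg.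
  by have [_ /(_ _ Fg)] := gP _ PA0.
split => [f [/Fin//|-> A PA]|A PA f f']; first by have [] := gP _ PA.
have [_ gA] := gP _ PA.
move=> /set_mem[Ff|->] /set_mem[Ff'|->] //=.
- by move=> ff'; apply: (Finj _ PA) => //; exact: mem_set.
- by move=> /(gA _ Ff).
- by move=> /esym/(gA _ Ff').
Qed.

Lemma mincardE (T : Type) (P : set (set T)) (A : set T) :
  P A -> (forall B, P B -> A #<= B) -> mincard P = card_of A.
Proof.
move=> PA Amin; apply/seteqP; split => [X [B [PB Bmin] XB]|X XA].
  apply: (card_eq_trans XB); rewrite card_eq_le Bmin//=; exact: Amin.
by exists A.
Qed.

Definition entourage : set (set (nat * nat)) := [set E | diagonal `<=` E].

(* [xsection E x] is E(x) and [xsection E^-1 x] is E^{-1}(x). *)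
Definition entourage_image (E : set (nat * nat)) (A : set nat) : set nat :=
  \bigcup_(a in A) xsection E a.

Definition cellular (E : set (nat * nat)) : Prop :=
  Equivalence (fun x y => E (x, y)).

Definition n_bounded (n : nat) (E : set (nat * nat)) : Prop :=
  forall x, xsection E x #<= `I_n /\ xsection E^-1 x #<= `I_n.

Definition finitary (E : set (nat * nat)) : Prop := exists n, n_bounded n E.

Definition locally_finite (E : set (nat * nat)) : Prop :=
  forall x, finite_set (xsection E x `|` xsection E^-1 x).

(* The cardinals indexing the families: finite ones, omega and omega_1. *)
Inductive cindex := Fin of nat | Omega | Omega1.

Definition in_2_omega (k : cindex) : Prop :=
  match k with Fin n => 2 <= n | Omega => True | Omega1 => False end.

Definition EE (k : cindex) : set (set (nat * nat)) :=
  entourage `&`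
  match k with
  | Fin n => n_bounded n
  | Omega => finitary
  | Omega1 => locally_finite
  end.

Definition EEo (k : cindex) : set (set (nat * nat)) := EE k `&` cellular.

Definition large (F : set (set (nat * nat))) : Prop :=
  forall L, infinite_set L ->
    exists2 E, F E & entourage_image E L = [set: nat].

Definition Delta (F : set (set (nat * nat))) : cardinal :=
  mincard [set F' | F' `<=` F /\
    forall D, infinite_set D -> exists2 E, F' E &
      infinite_set [set x | D x /\ D `&` xsection E x <> [set x]]].

Definition Sigma (F : set (set (nat * nat))) : cardinal :=
  mincard [set F' | F' `<=` F /\
    forall A B, infinite_set A -> infinite_set B -> exists2 E, F' E &
      infinite_set (entourage_image E A `&` entourage_image E B)].

Definition Lambda (F : set (set (nat * nat))) : cardinal :=
  mincard [set F' | F' `<=` F /\ large F'].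

Definition S_omega : set (nat -> nat) := [set h | bijective h].

Definition Delta_S : cardinal :=
  mincard [set H | H `<=` S_omega /\
    forall A, infinite_set A -> exists2 h, H h &
      infinite_set [set a | [/\ A a, a <> h a & A (h a)]]].

Definition Sigma_S : cardinal :=
  mincard [set H | H `<=` S_omega /\
    forall A B, infinite_set A -> infinite_set B -> exists2 h, H h &
      infinite_set (h @` A `&` B)].

Definition eventually_le (f g : nat -> nat) : Prop :=
  \forall n \near \oo, f n <= g n.

Definition cardinal_b : cardinal :=
  mincard [set F | ~ exists g, forall f, F f -> eventually_le f g].

Definition cardinal_d : cardinal :=
  mincard [set F | forall f, exists2 g, F g & eventually_le f g].

Definition cardinal_c : cardinal := card_of [set: nat -> bool].

(* Main.v *)
Require Import Defs.
From mathcomp Require Import all_boot.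
From mathcomp Require Import boolp classical_sets functions cardinality filter.

Set Implicit Arguments.
Unset Strict Implicit.
Unset Printing Implicit Defensive.

Local Open Scope classical_set_scope.
Local Open Scope card_scope.
Local Open Scope relation_scope.

(** Each cardinal here is the least size of a family that answers a given set of
    challenges.  Inequalities between such norms come from Galois-Tukey
    connections: turn every challenge of the first problem into a challenge of
    the second, and every answer of the second into an answer of the first
    [tukey_le].  An answer may also be turned into countably many answers as
    long as the families answering the second problem are infinite, because
    unions of countable sets over an infinite index set D have size at most
    that of D [tukey_le_countable].

    Locally finite entourages.  Such an entourage E is controlled by a function
    f, the E-neighbours of the points up to n being at most f n.  Conversely, a
    function f gives the cellular entourage whose cells are the intervals
    [[d k, d (k+1))] of a sequence growing faster than f.  If the functions of a
    family of entourages were all eventually below g, then no E of the family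
    would link two far points of a set that is sparse with respect to g: hence
    b <= Delta.  Splitting a set into two disjoint halves A, B and replacing E
    by the composition of E with its inverse gives Delta <= Sigma.  Finally
    Sigma <= b, because a function that is often above the one measuring the
    gaps of A and of B yields infinitely many intervals that meet both.  The
    same translation with eventual domination gives Lambda = d; as equality
    E[L] = omega tolerates no finite exception, one needs for each function
    countably many interval partitions, which differ in their first cell.

    Finitary entourages.  The cardinal c bounds Lambda because two-point cells
    suffice to blow an infinite set up to omega, and there are only c
    entourages.  For the other inequality take an almost disjoint family of c
    infinite sets: if E[L] = omega for n+1 of them, a point x far enough away
    has n+1 distinct E-predecessors, so an n-bounded E serves at most n of them.
    For Delta and Sigma, a greedy colouring in which distinct points with a
    common neighbour get different colours splits a finitary symmetric relation
    into finitely many partial involutions [finitary_cover]; one of them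
    inherits the infinitely many coincidences witnessed by E.  The graph of an
    involution together with the diagonal is in turn a cellular entourage with
    cells of at most two points, so all the families between these cells and
    all finitary entourages yield the same cardinal as permutations do. *)

(** * Unions of countable sets *)

Lemma inj_fun_card_le T U (A : set T) (B : set U) (f : T -> U) :
  (forall x, A x -> B (f x)) ->
  (forall x y, A x -> A y -> f x = f y -> x = y) -> A #<= B.
Proof.
move=> fAB finj.
suff [g] : $|{injfun A >-> B}| by exact: inj_card_le.
apply/injfunPex; exists f => // x y /set_mem Ax /set_mem Ay; exact: finj.
Qed.

Lemma infinite_injseq T (A : set T) : infinite_set A ->
  exists2 s : nat -> T, injective s & forall n, A (s n).
Proof.
move=> Ainf; have [x0 _] := infinite_setN0 Ainf.
move/infiniteP: Ainf; elim/Ppointed: T => T in A x0 *.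
  by have := no x0.
move=> /pcard_leP[s]; exists s; last by move=> n; exact: (@funS _ _ _ _ s n).
by move=> m n; apply: (@inj _ _ _ s); rewrite inE.
Qed.

Lemma injseq_infinite T (A : set T) (s : nat -> T) :
  injective s -> (forall n, A (s n)) -> infinite_set A.
Proof.
move=> sinj sA; apply/infiniteP.
by apply: (inj_fun_card_le (f := s)) => // x y _ _ /sinj.
Qed.

(** This is the equality of D and D x omega for infinite D in the form in which
    it is used.  A maximal family of disjoint copies of omega inside D leaves
    out only a finite set R.  Grouping the indices by these copies, each group
    being completed by R, makes the union a union of countable sets indexed by
    the copies, and each of them injects into its own copy. *)
Lemma card_bigcup_countable I T (D : set I) (G : I -> set T) :
  infinite_set D -> (forall i, D i -> countable (G i)) ->
  \bigcup_(i in D) G i #<= D.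
Proof.
move=> Dinf cG.
have [E [ED Etriv Emax]] := ex_maximal_disjoint_subcollection
  (fun s : nat -> I => range s) [set s | injective s /\ range s `<=` D].
pose R := D `\` \bigcup_(s in E) range s.
have Rfin : finite_set R.
  apply: contrapT => /infinite_injseq[s sinj sR].
  have sE : ~ E s.
    by move=> Es; have [_] := sR 0; apply; exists s => //; exists 0.
  apply: (Emax (E `|` [set s])).
  - split; first by move=> t Et; left.
    by move=> /(_ s (or_intror erefl)).
  - by move=> t [/ED//|->]; split=> // _ [n _ <-]; have [] := sR n.
  - move=> t u [Et|->] [Eu|->] //; first exact: Etriv.
    + move=> [x [[n _ tx] [m _ sx]]]; have [_] := sR m; case.
      by exists t => //; exists n => //; rewrite tx sx.
    + move=> [x [[n _ sx] [m _ ux]]]; have [_] := sR n; case.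
      by exists u => //; exists m => //; rewrite ux sx.
have [s0 Es0] : E !=set0.
  apply/set0P/negP => /eqP E0; apply: Dinf.
  by move: Rfin; rewrite /R E0 bigcup_set0 setD0.
pose K (s : nat -> I) := \bigcup_(i in range s `|` R) G i.
have cK s : E s -> countable (K s).
  move=> Es; apply: bigcup_countable => [|i [si|[Di _]]].
  - apply: (@sub_countable _ _ _ (range s `|` R)); first exact: card_lexx.
    rewrite -bigcup2E; apply: bigcup_countable => // -[|[|n]] _ /=.
    + exact: (card_le_trans (card_image_le _ _)).
    + exact: finite_set_countable.
    + exact: countable0.
  - by apply: cG; have [_] := ED _ Es; apply.
  - exact: cG.
have /choice[k kP] s : exists k : T -> nat, E s -> {in K s &, injective k}.
  have [/cK/countable_injP[k kinj]|nE] := pselect (E s); first by exists k.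
  by exists (fun=> 0).
have /choice[sg sgP] y : exists s, E s /\ ((\bigcup_(i in D) G i) y -> K s y).
  have [[i Di Giy]|nD] := pselect ((\bigcup_(i in D) G i) y); last by exists s0.
  have [[s Es si]|nE] := pselect ((\bigcup_(s in E) range s) i).
    by exists s; split=> // _; exists i => //; left.
  by exists s0; split=> // _; exists i => //; right.
apply: (inj_fun_card_le (f := fun y => sg y (k (sg y) y)))
  => [y _|x y Dx Dy exy].
  by have [/ED[_ sub] _] := sgP y; apply: sub; exists (k (sg y) y).
have [[Ex /(_ Dx) Kx] [Ey /(_ Dy) Ky]] := (sgP x, sgP y).
have sxy : sg x = sg y.
  apply: Etriv => //; exists (sg x (k (sg x) x)).
  by split; [exists (k (sg x) x)|exists (k (sg y) y)].
have [sinj _] := ED _ Ex; move: exy Ky; rewrite -sxy => /sinj ek Ky.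
by apply: (kP _ Ex) ek; exact: mem_set.
Qed.

(** * Comparing minimal cardinalities *)

(** The minima are Frege cardinals, which carry no order; this is the inequality
    between them, in a form that is also meaningful for empty sets of
    families. *)
Definition mincard_le T U (P : set (set T)) (Q : set (set U)) :=
  forall B, Q B -> exists2 A, P A & A #<= B.

Lemma mincard_le_trans T U V (P : set (set T)) (Q : set (set U))
    (R : set (set V)) : mincard_le P Q -> mincard_le Q R -> mincard_le P R.
Proof.
move=> PQ QR C /QR[B /PQ[A PA AB] BC]; exists A => //.
exact: card_le_trans BC.
Qed.

Lemma mincard_le_anti T U (P : set (set T)) (Q : set (set U)) :
  mincard_le P Q -> mincard_le Q P -> mincard P = mincard Q.
Proof.
move=> PQ QP; have [Q0|Q0] := pselect (Q !=set0); last first.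
  have nQ B : ~ Q B by move=> QB; apply: Q0; exists B.
  have nP A : ~ P A by move=> /QP[B /nQ].
  by apply/seteqP; split => [X [A [/nP]]|X [A [/nQ]]].
have [B QB Bmin] := mincard_attained Q0.
have [A' PA' A'B] := PQ _ QB.
have [A PA Amin] := mincard_attained (ex_intro _ A' PA').
have [B' QB' B'A] := QP _ PA.
have AB : A #= B.
  rewrite card_eq_le; apply/andP; split.
    exact: card_le_trans (Amin _ PA') A'B.
  exact: card_le_trans (Bmin _ QB') B'A.
rewrite (mincardE PA Amin) (mincardE QB Bmin).
apply/seteqP; split => X /= XX; apply: card_eq_trans XX _ => //.
by rewrite card_eq_sym.
Qed.

(** X consists of the challenges, Y of the possible answers, and R says that an
    answer meets a challenge. *)
Definition dominating I T (X : set I) (Y : set T) (R : I -> T -> Prop) :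
    set (set T) :=
  [set F | F `<=` Y /\ forall x, X x -> exists2 y, F y & R x y].

(** The relation G links a challenge to its translations; it is a relation and
    not a function so that translations need not be chosen beforehand. *)
Lemma tukey_le I T I' T' (X : set I) (Y : set T) (R : I -> T -> Prop)
    (X' : set I') (Y' : set T') (R' : I' -> T' -> Prop) (G : I -> I' -> Prop) :
  (forall x, X x -> exists2 x', X' x' & G x x') ->
  (forall y', Y' y' -> exists2 y, Y y &
     forall x x', X x -> X' x' -> G x x' -> R' x' y' -> R x y) ->
  mincard_le (dominating X Y R) (dominating X' Y' R').
Proof.
move=> XG YR B [BY BR].
have [[b /BY/YR[y0 _ _]]|B0] := pselect (B !=set0); last first.
  exists set0; last exact: card_ge0.
  by split=> // x /XG[x' /BR[y By _]]; case: B0; exists y.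
have /choice[psi psiP] y' : exists y, Y' y' -> Y y /\
    forall x x', X x -> X' x' -> G x x' -> R' x' y' -> R x y.
  by have [/YR[y Yy yR]|nY] := pselect (Y' y'); [exists y | exists y0].
exists (psi @` B); last exact: card_image_le.
split=> [_ [y' /BY/psiP[Yy _] <-]//|x Xx].
have [x' Xx' xx'] := XG x Xx; have [y' By' xy'] := BR _ Xx'.
have [_ psiR] := psiP _ (BY _ By').
by exists (psi y'); [exists y' | exact: (psiR _ _ Xx Xx' xx' xy')].
Qed.

(** Here an answer of the second problem translates into a countable set of
    candidates, one of which is right. *)
Lemma tukey_le_countable I T I' T' (X : set I) (Y : set T) (R : I -> T -> Prop)
    (X' : set I') (Y' : set T') (R' : I' -> T' -> Prop) (G : I -> I' -> Prop) :
  (forall B, dominating X' Y' R' B -> infinite_set B) ->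
  (forall x, X x -> exists2 x', X' x' & G x x') ->
  (forall y', Y' y' -> exists C, [/\ countable C, C `<=` Y &
     forall x x', X x -> X' x' -> G x x' -> R' x' y' ->
       exists2 y, C y & R x y]) ->
  mincard_le (dominating X Y R) (dominating X' Y' R').
Proof.
move=> Binf XG YR B BR; have := Binf B BR; case: BR => BY BR {}Binf.
have /choice[C CP] y' : exists C, Y' y' -> [/\ countable C, C `<=` Y &
    forall x x', X x -> X' x' -> G x x' -> R' x' y' -> exists2 y, C y & R x y].
  by have [/YR[C CP]|nY] := pselect (Y' y'); [exists C | exists set0].
exists (\bigcup_(y' in B) C y').
  split=> [y [y' /BY/CP[_ CY _] /CY]//|x Xx].
  have [x' Xx' xx'] := XG x Xx; have [y' By' xy'] := BR _ Xx'.
  have [_ _ /(_ _ _ Xx Xx' xx' xy')[y Cy xy]] := CP _ (BY _ By').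
  by exists y => //; exists y'.
by apply: card_bigcup_countable => // y' /BY/CP[].
Qed.

Lemma dominating_antitone I T (X : set I) (Y Y' : set T) R :
  Y' `<=` Y -> mincard_le (dominating X Y R) (dominating X Y' R).
Proof.
move=> Y'Y F [FY' FR]; exists F => //; split=> //; exact: subset_trans Y'Y.
Qed.

(** * The cardinals as norms of challenge problems *)

Definition infinite_sets : set (set nat) := [set A | infinite_set A].

Definition infinite_pairs : set (set nat * set nat) :=
  [set AB | infinite_set AB.1 /\ infinite_set AB.2].

Definition Delta_good (D : set nat) (E : set (nat * nat)) : Prop :=
  infinite_set [set x | D x /\ D `&` xsection E x <> [set x]].

Definition Sigma_good (AB : set nat * set nat) (E : set (nat * nat)) : Prop :=
  infinite_set (entourage_image E AB.1 `&` entourage_image E AB.2).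

Definition Lambda_good (L : set nat) (E : set (nat * nat)) : Prop :=
  entourage_image E L = [set: nat].

Lemma DeltaE F : Delta F = mincard (dominating infinite_sets F Delta_good).
Proof. by []. Qed.

Lemma SigmaE F : Sigma F = mincard (dominating infinite_pairs F Sigma_good).
Proof.
congr mincard; apply/seteqP; split=> F' [F'F F'good]; split=> //.
  by move=> [A B] [Ainf Binf]; exact: F'good.
by move=> A B Ainf Binf; exact: (F'good (A, B)).
Qed.

Lemma LambdaE F : Lambda F = mincard (dominating infinite_sets F Lambda_good).
Proof. by []. Qed.

Lemma cardinal_bE : cardinal_b =
  mincard (dominating [set: nat -> nat] setT (fun g f => ~ eventually_le f g)).
Proof.
congr mincard; apply/seteqP; split=> F.
  move=> Fub; split=> // g _; apply: contrapT => noF.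
  apply: Fub; exists g => f Ff.
  by apply: contrapT => nfg; apply: noF; exists f.
by move=> [_ Fub] [g gF]; have [//|f /gF fg] := Fub g.
Qed.

Lemma cardinal_dE :
  cardinal_d = mincard (dominating [set: nat -> nat] setT eventually_le).
Proof.
congr mincard; apply/seteqP; split=> F; first by move=> Fd; split.
by move=> [_ Fd] f; exact: Fd.
Qed.

(** * Sets and functions of natural numbers *)

Lemma finite_natP (A : set nat) :
  finite_set A <-> exists n, forall m, A m -> m < n.
Proof.
split=> [/finite_seqP[s ->]|[n An]]; last first.
  by apply: (sub_finite_set _ (finite_II n)) => m /An.
exists (\max_(i <- s) i).+1 => m ms; rewrite ltnS.
exact: (@leq_bigmax_seq _ s xpredT id m ms isT).
Qed.

Lemma infinite_natP (A : set nat) :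
  infinite_set A <-> forall n, exists2 m, n <= m & A m.
Proof.
split=> [Ainf n|Aub /finite_natP[n An]].
  apply: contrapT => noA; apply: Ainf; apply/finite_natP; exists n => m Am.
  by rewrite ltnNge; apply/negP => nm; apply: noA; exists m.
by have [m + /An] := Aub n; rewrite leqNgt => /negP.
Qed.

Lemma not_eventually_leP f g :
  ~ eventually_le f g <-> forall N, exists2 n, N <= n & g n < f n.
Proof.
split=> [nfg N|fg [N _ Nfg]].
  apply: contrapT => noN; apply: nfg; exists N => // n /= Nn.
  by rewrite leqNgt; apply/negP => gf; apply: noN; exists n.
by have [n /Nfg/=] := fg N; rewrite leqNgt => /negP.
Qed.

Definition running_max (f : nat -> nat) (n : nat) : nat := \max_(i < n.+1) f i.

Lemma running_max_ge f m n : m <= n -> f m <= running_max f n.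
Proof.
rewrite -ltnS => mn.
exact: (@leq_bigmax _ (fun i : 'I_n.+1 => f i) (Ordinal mn)).
Qed.

Lemma running_max_homo f : {homo running_max f : m n / m <= n}.
Proof.
move=> m n mn; apply/bigmax_leqP => i _; apply: running_max_ge.
by apply: leq_trans mn; rewrite -ltnS.
Qed.

(** A sequence that jumps over g at each step.  Its range serves as a sparse
    infinite set, and its terms as the end points of an interval partition. *)
Definition sparse (g : nat -> nat) (x0 k : nat) : nat :=
  iter k (fun x => (maxn x (running_max g x)).+1) x0.

Lemma sparse_step g x0 k x : x <= sparse g x0 k -> g x < sparse g x0 k.+1.
Proof.
move=> xk; rewrite /sparse iterS ltnS leq_max; apply/orP; right.
exact: running_max_ge.
Qed.

Lemma homo_ltn_step (d : nat -> nat) :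
  (forall k, d k < d k.+1) -> {homo d : i j / i < j}.
Proof.
by move=> dS; apply: homo_ltn => // y x z; exact: ltn_trans.
Qed.

Lemma sparse_ltn g x0 : {homo sparse g x0 : i j / i < j}.
Proof.
by apply: homo_ltn_step => k; rewrite /sparse iterS ltnS leq_maxl.
Qed.

Lemma sparse_inj g x0 : injective (sparse g x0).
Proof.
move=> i j; case: (ltngtP i j) => // /(@sparse_ltn g x0).
  by move=> + e; rewrite e ltnn.
by move=> + e; rewrite e ltnn.
Qed.

Lemma sparse_infinite g x0 : infinite_set (range (sparse g x0)).
Proof.
by apply: (injseq_infinite (@sparse_inj g x0)) => n; exists n.
Qed.

Lemma sparse_gap g x0 i j x :
  x <= sparse g x0 i -> i < j -> g x < sparse g x0 j.
Proof.
move=> xi; rewrite leq_eqVlt => /orP[/eqP<-|]; first exact: sparse_step.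
by move=> /(@sparse_ltn g x0); apply: ltn_trans; exact: sparse_step.
Qed.

Lemma infinite_split (D : set nat) : infinite_set D ->
  exists AB : set nat * set nat,
    [/\ infinite_pairs AB, AB.1 `<=` D, AB.2 `<=` D &
        forall a b, AB.1 a -> AB.2 b -> a <> b].
Proof.
move=> /infinite_injseq[s sinj sD].
exists (range (s \o double), range (s \o S \o double)) => /=; split.
- split=> /=.
    apply: (@injseq_infinite _ _ (s \o double)) => [m n /=|n]; last by exists n.
    by move=> /sinj/double_inj.
  apply: (@injseq_infinite _ _ (s \o S \o double)) => [m n /=|n].
    by move=> /sinj[/double_inj].
  by exists n.
- by move=> _ [n _ <-] /=.
- by move=> _ [n _ <-] /=.
- move=> _ _ [m _ <-] [n _ <-] /= /sinj /(congr1 odd).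
  by rewrite oddS !odd_double.
Qed.

(** * Locally finite entourages *)

Lemma locally_finite_bound E : locally_finite E ->
  exists2 f : nat -> nat, {homo f : m n / m <= n} &
    forall x y n, x <= n -> E (x, y) \/ E (y, x) -> y <= f n.
Proof.
move=> Elf.
have /choice[f fP] x : exists n, forall y, E (x, y) \/ E (y, x) -> y < n.
  have /finite_natP[n nP] := Elf x; exists n => y Exy; apply: nP.
  by case: Exy => ?; [left|right]; apply/xsectionP.
exists (running_max f); first exact: running_max_homo.
move=> x y n xn /fP/ltnW yf; apply: (leq_trans yf); exact: running_max_ge.
Qed.

Lemma locally_finite_xsection E x :
  locally_finite E -> finite_set (xsection E x).
Proof. by move=> /(_ x); rewrite finite_setU => -[]. Qed.

Lemma locally_finite_xsectionV E x :
  locally_finite E -> finite_set (xsection E^-1 x).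
Proof. by move=> /(_ x); rewrite finite_setU => -[]. Qed.

Lemma Delta_goodE E D : entourage E ->
  [set x | D x /\ D `&` xsection E x <> [set x]] =
  [set x | D x /\ exists y, [/\ D y, y <> x & E (x, y)]].
Proof.
move=> Ediag; apply/seteqP; split=> x [Dx Ex]; split=> //.
  apply: contrapT => noy; apply: Ex; apply/seteqP; split=> y /=.
    move=> [Dy /xsectionP Exy]; apply: contrapT => yx; apply: noy.
    by exists y; split.
  by move=> ->; split=> //; apply/xsectionP; exact: Ediag.
move=> e; have [y [Dy yx /xsectionP Exy]] := Ex; apply: yx.
suff : (D `&` xsection E x) y by rewrite e.
by split.
Qed.

(** Split D into disjoint halves A and B: a point of E[A] meeting E[B] links a
    point of A to a different point of B in the composition of E with its
    inverse. *)
Lemma Delta_le_Sigma (F F' : set (set (nat * nat))) :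
  F' `<=` locally_finite ->
  (forall E, F' E -> exists2 E2, F E2 /\ entourage E2 &
     forall x y z, E (x, z) -> E (y, z) -> E2 (x, y)) ->
  mincard_le (dominating infinite_sets F Delta_good)
             (dominating infinite_pairs F' Sigma_good).
Proof.
move=> F'lf F'F.
apply: (@tukey_le _ _ _ _ _ _ _ _ _ _ (fun D AB =>
  [/\ AB.1 `<=` D, AB.2 `<=` D & forall a b, AB.1 a -> AB.2 b -> a <> b])).
  by move=> D /infinite_split[AB [ABinf AD BD AB0]]; exists AB.
move=> E F'E; have [E2 [FE2 E2diag] EE2] := F'F _ F'E; exists E2 => //.
move=> D [A B] _ _ [/= AD BD AB0]; apply: contra_not => /=.
rewrite Delta_goodE //; set S := [set x | _] => Sfin.
apply: (@sub_finite_set _ _ (\bigcup_(x in S) xsection E x)).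
  move=> z [[a Aa Eaz] [b Bb Ebz]]; exists a => //; split; first exact: AD.
  exists b; split; [exact: BD | by move=> /esym; exact: AB0 |].
  by apply: (EE2 a b z); exact/xsectionP.
apply: bigcup_finite => // x _; apply: locally_finite_xsection; exact: F'lf.
Qed.

(** The challenge g becomes a set D whose consecutive points are further apart
    than g.  If the bound f of E were eventually below g, two linked points of D
    could occur only below the place where f gets under g. *)
Lemma b_le_Delta : mincard_le
  (dominating [set: nat -> nat] setT (fun g f => ~ eventually_le f g))
  (dominating infinite_sets (EE Omega1) Delta_good).
Proof.
apply: (@tukey_le _ _ _ _ _ _ _ _ _ _ (fun g D => D = range (sparse g 0))).
  by move=> g _; exists (range (sparse g 0)) => //; exact: sparse_infinite.
move=> E [Ediag /locally_finite_bound[f fhomo fE]]; exists f => // g D _ _ ->.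
rewrite /Delta_good Delta_goodE // => + [N _ Nfg]; apply.
(* A linked point is either below N itself or a neighbour of a point below N. *)
apply/finite_natP; exists (N + f N).+1 => x [[i _ <-] [y [[j _ <-] ji Eij]]].
rewrite ltnS; have [ij|ij|e] := ltngtP i j; last by rewrite e in ji.
- apply: leq_trans (leq_addr _ _); rewrite leqNgt; apply/negP => Ni.
  have := sparse_gap (leqnn (sparse g 0 i)) ij; apply/negP; rewrite -leqNgt.
  apply: (leq_trans (fE _ _ _ (leqnn _) (or_introl Eij))); apply: Nfg.
  exact: ltnW.
- apply: leq_trans (leq_addl _ _); have [jN|Nj] := leqP (sparse g 0 j) N.
    by apply: fE jN _; right.
  have := sparse_gap (leqnn (sparse g 0 j)) ij; rewrite ltnNge => /negP[].
  apply: (leq_trans (fE _ _ _ (leqnn _) (or_intror Eij))); apply: Nfg.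
  exact: ltnW.
Qed.

(** * Interval partitions *)

(** The partition into the intervals between consecutive values of d, described
    through the end points lying to the left of each point, so that it is an
    equivalence relation whatever d is. *)
Definition blocks (d : nat -> nat) : set (nat * nat) :=
  [set p | forall k, (d k <= p.1) = (d k <= p.2)].

Lemma blocks_cellular d : cellular (blocks d).
Proof.
split=> [x k //|x y xy k|x y z xy yz k]; first exact/esym/xy.
exact: etrans (xy k) (yz k).
Qed.

Lemma blocks_EEo d : {homo d : i j / i < j} -> EEo Omega1 (blocks d).
Proof.
move=> dlt; split; last exact: blocks_cellular.
split=> [[x y] xy k|x]; first by rewrite /= (xy : x = y).
apply/finite_natP; exists (d x.+1) => y.
have xd : x < d x.+1.
  by elim: x.+1 => // k IHk; apply: leq_ltn_trans IHk _; exact: dlt.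
rewrite ltnNge => -[] /xsectionP.
  by move=> /(_ x.+1) /= <-; rewrite -ltnNge.
by move=> /(_ x.+1) /= ->; rewrite -ltnNge.
Qed.

Lemma blocksP d k x y : {homo d : i j / i < j} ->
  d k <= x < d k.+1 -> d k <= y < d k.+1 -> blocks d (x, y).
Proof.
move=> dlt /andP[kx xk] /andP[ky yk] i /=.
have dle : {homo d : i j / i <= j}.
  by move=> a b; rewrite leq_eqVlt => /orP[/eqP->//|/dlt/ltnW].
have [ik|ki] := leqP i k; first by rewrite !(leq_trans (dle _ _ ik)).
by rewrite leqNgt (leq_trans xk (dle _ _ ki)) leqNgt
  (leq_trans yk (dle _ _ ki)).
Qed.

Lemma blocks_cover d x : d 0 = 0 -> {homo d : i j / i < j} ->
  exists k, d k <= x < d k.+1.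
Proof.
move=> d0 dlt; have [||k dkx kmax] := @ex_maxnP (fun k => d k <= x) x.
- by exists 0; rewrite d0.
- move=> k; apply: leq_trans.
  by elim: k => // k IHk; apply: leq_ltn_trans IHk _; exact: dlt.
by exists k; rewrite dkx ltnNge; apply/negP => /kmax; rewrite ltnn.
Qed.

Definition meets (A : set nat) (m n : nat) : Prop :=
  exists2 a, A a & m <= a < n.

Lemma infinite_meets A : infinite_set A -> exists f, forall n, meets A n (f n).
Proof.
move=> /infinite_natP Ainf.
have /choice[f fP] n : exists m, meets A n m.
  have [m nm Am] := Ainf n; exists m.+1; exists m => //.
  by rewrite nm ltnS leqnn.
by exists f.
Qed.

Lemma meetsW A m n m' n' : meets A m n -> m' <= m -> n <= n' -> meets A m' n'.
Proof.
move=> [a Aa /andP[ma an]] mm nn; exists a => //.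
by rewrite (leq_trans mm ma) (leq_trans an nn).
Qed.

(** For A and B, let h n be so large that [[n, h n)] splits into two consecutive
    intervals, each meeting both A and B.  When f n > h n, the interval
    [[n, h n)] contains at most one end point of the partition built from f, so
    one of its two parts lies in a single cell: taking two parts is what allows
    one partition per function. *)
Lemma Sigma_le_b : mincard_le
  (dominating infinite_pairs (EEo Omega1) Sigma_good)
  (dominating [set: nat -> nat] setT (fun g f => ~ eventually_le f g)).
Proof.
apply: (@tukey_le _ _ _ _ _ _ _ _ _ _ (fun (AB : set nat * set nat) h =>
   forall n, exists m, [/\ meets AB.1 n m, meets AB.2 n m,
     meets AB.1 m (h n) & meets AB.2 m (h n)])).
  move=> [A B] [/= /infinite_meets[f fP] /infinite_meets[g gP]].
  pose p n := maxn (f n) (g n).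
  exists (p \o p) => // n; exists (p n); split.
  - exact: meetsW (fP n) (leqnn _) (leq_maxl _ _).
  - exact: meetsW (gP n) (leqnn _) (leq_maxr _ _).
  - exact: meetsW (fP (p n)) (leqnn _) (leq_maxl _ _).
  - exact: meetsW (gP (p n)) (leqnn _) (leq_maxr _ _).
move=> f _; pose d := sparse f 0.
have dlt : {homo d : i j / i < j} by exact: sparse_ltn.
exists (blocks d); first exact: blocks_EEo.
move=> [A B] h _ _ ABh /not_eventually_leP fh; apply/infinite_natP => N /=.
have sameblock k m n : N <= m -> d k <= m -> n <= d k.+1 ->
    meets A m n -> meets B m n -> exists2 z, N <= z &
    (entourage_image (blocks d) A `&` entourage_image (blocks d) B) z.
  move=> Nm km nk [a Aa /andP[ma an]] [b Bb /andP[mb bn]].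
  exists a; first exact: leq_trans ma.
  have ka : d k <= a < d k.+1 by rewrite (leq_trans km ma) (leq_trans an nk).
  have kb : d k <= b < d k.+1 by rewrite (leq_trans km mb) (leq_trans bn nk).
  split; [exists a|exists b] => //; apply/xsectionP.
    exact: (blocksP dlt ka ka).
  exact: (blocksP dlt kb ka).
have [n Nn hf] := fh N.
have [k /andP[kn nk]] := blocks_cover n (erefl : d 0 = 0) dlt.
have [m [An Bn Am Bm]] := ABh n; have [mk|km] := leqP m (d k.+1).
  exact: (sameblock k n m).
apply: (sameblock k.+1 m (h n)) => //.
- by apply: ltnW; apply: leq_ltn_trans Nn _; exact: leq_trans nk (ltnW km).
- exact: ltnW.
- by apply: ltnW; apply: ltn_trans hf _; apply: sparse_step; exact: ltnW.
Qed.

(** If E[L] = omega and b bounds E, the point (b n) + 1 is not a neighbour of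
    any point up to n, so L has a point between n and g n = b ((b n) + 1).
    Using this twice, L has two points between n and g (g n); when the gaps of L
    exceed f, this forces f n <= g (g n). *)
Lemma d_le_Lambda : mincard_le
  (dominating [set: nat -> nat] setT eventually_le)
  (dominating infinite_sets (EE Omega1) Lambda_good).
Proof.
apply: (@tukey_le _ _ _ _ _ _ _ _ _ _ (fun f L => L = range (sparse f 0))).
  by move=> f _; exists (range (sparse f 0)) => //; exact: sparse_infinite.
move=> E [_ /locally_finite_bound[b bhomo bE]].
pose g n := b (b n).+1; exists (g \o g) => // f L _ _ -> EL.
have hit n : exists2 i, n < sparse f 0 i & sparse f 0 i <= g n.
  have [_ [i _ <-] /xsectionP Ei] :
      entourage_image E (range (sparse f 0)) (b n).+1.
    by rewrite EL.
  exists i; last by apply: bE (leqnn _) _; right.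
  rewrite ltnNge; apply/negP => /bE /(_ (or_introl Ei)).
  by rewrite ltnn.
exists 0 => // n _ /=; have [i ni ig] := hit n.
have [j ij jg] := hit (sparse f 0 i).
apply: (@leq_trans (sparse f 0 j)).
  apply: ltnW; apply: sparse_gap (ltnW ni) _; rewrite ltnNge; apply/negP.
  rewrite leq_eqVlt => /orP[/eqP e|/(@sparse_ltn f 0)/(ltn_trans ij)].
    by rewrite e ltnn in ij.
  by rewrite ltnn.
apply: (leq_trans jg); apply: (bhomo); rewrite ltnS.
exact: bhomo.
Qed.

(** Finitely many functions have a common strict upper bound. *)
Lemma dominating_infinite F :
  dominating [set: nat -> nat] setT eventually_le F -> infinite_set F.
Proof.
move=> [_ Fd] Ffin.
have /choice[f fP] n : exists m, forall g, F g -> g n < m.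
  have /finite_natP[m mP] := finite_image (fun g : nat -> nat => g n) Ffin.
  by exists m => g Fg; apply: mP; exists g.
have [//|g Fg [N _ /(_ N (leqnn N))/=]] := Fd f.
by rewrite leqNgt fP.
Qed.

(** If g is above the gap function h of L from M on, then every interval
    [[n, g n)] with n >= M meets L.  The first cell has to be adjusted to L: it
    is [[0, N+1)] with N >= M and N >= h 0, and N is the countable parameter. *)
Lemma Lambda_le_d : mincard_le
  (dominating infinite_sets (EEo Omega1) Lambda_good)
  (dominating [set: nat -> nat] setT eventually_le).
Proof.
apply: (@tukey_le_countable _ _ _ _ _ _ _ _ _ _
  (fun L h => forall n, meets L n (h n))); first exact: dominating_infinite.
  by move=> L /infinite_meets[h hP]; exists h.
move=> g _; pose d N k := if k is k'.+1 then sparse g N.+1 k' else 0.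
have dlt N : {homo d N : i j / i < j}.
  apply: homo_ltn_step => -[|k]; first by rewrite /d /sparse.
  exact: sparse_ltn.
exists (range (fun N => blocks (d N))); split.
- exact: card_le_trans (card_image_le _ _) (card_lexx _).
- by move=> _ [N _ <-]; exact: blocks_EEo.
move=> L h _ _ Lh [M _ Mhg].
pose N := maxn M (h 0); exists (blocks (d N)); first by exists N.
apply/seteqP; split=> // x _; have [k xk] := blocks_cover x erefl (dlt N).
suff [l Ll lk] : meets L (d N k) (d N k.+1).
  by exists l => //; apply/xsectionP; exact: (blocksP (dlt N) lk xk).
apply: (meetsW (Lh (d N k))) => //; case: k {xk} => [|k].
  by apply: leqW; exact: leq_maxr.
apply: leq_trans (Mhg _ _) _ => /=; last by apply: ltnW; exact: sparse_step.
apply: leq_trans (leq_maxl _ (h 0)) _; apply: ltnW; rewrite -/N.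
by elim: k => // k IHk; apply: ltn_trans IHk _; exact: sparse_ltn.
Qed.

(** A locally finite relation has an infinite independent set, found by jumping
    over all the points already excluded; this is why no finite family answers
    the challenges of Delta or Sigma. *)
Lemma finite_family_independent (F : set (set (nat * nat))) :
  finite_set F -> F `<=` locally_finite ->
  exists2 D, infinite_set D & forall E x y z,
    F E -> D x -> D y -> E (x, z) -> E (y, z) -> x = y.
Proof.
move=> Ffin Flf.
have /choice[g gP] x : exists n, forall E y z,
    F E -> E (x, z) -> E (y, z) -> y < n.
  have [|n nP] := (finite_natP (\bigcup_(E in F) \bigcup_(z in xsection E x)
    xsection E^-1 z)).1.
    apply: bigcup_finite => // E /Flf Elf; apply: bigcup_finite => [|z _].
      exact: locally_finite_xsection.
    exact: locally_finite_xsectionV.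
  exists n => E y z FE Exz Eyz; apply: nP; exists E => //.
  by exists z; apply/xsectionP.
exists (range (sparse g 0)); first exact: sparse_infinite.
move=> E x y z FE [i _ <-] [j _ <-] Ei Ej; have [ij|ij|->//] := ltngtP i j.
  have := gP _ _ _ _ FE Ei Ej; rewrite ltnNge ltnW //.
  exact: sparse_gap (leqnn _) ij.
have := gP _ _ _ _ FE Ej Ei; rewrite ltnNge ltnW //.
exact: sparse_gap (leqnn _) ij.
Qed.

Lemma Delta_dominating_infinite Y F :
  Y `<=` EE Omega1 -> dominating infinite_sets Y Delta_good F -> infinite_set F.
Proof.
move=> YO [FY Fgood] Ffin.
have [|D Dinf Dind] := finite_family_independent Ffin.
  by move=> E /FY/YO[].
have [E FE] := Fgood D Dinf; have [Ediag _] := YO _ (FY _ FE).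
rewrite /Delta_good Delta_goodE //; apply.
apply: (sub_finite_set _ (finite_set0 nat)) => x [Dx [y [Dy yx Exy]]].
by apply: yx; apply: (Dind E y x y) => //; exact: Ediag.
Qed.

Lemma Sigma_dominating_infinite Y F :
  Y `<=` EE Omega1 -> dominating infinite_pairs Y Sigma_good F ->
  infinite_set F.
Proof.
move=> YO [FY Fgood] Ffin.
have [|D Dinf Dind] := finite_family_independent Ffin.
  by move=> E /FY/YO[].
have [[A B] [ABinf /= AD BD AB0]] := infinite_split Dinf.
have [E FE] := Fgood _ ABinf; apply.
apply: (sub_finite_set _ (finite_set0 nat)).
move=> z [[a Aa /xsectionP Eaz] [b Bb /xsectionP Ebz]].
by apply: (AB0 a b) => //; apply: (Dind E a b z) => //; [exact: AD|exact: BD].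
Qed.

(** * The hierarchy of the families *)

Lemma n_bounded_leq m n E : m <= n -> n_bounded m E -> n_bounded n E.
Proof.
move=> mn Em x; have [Ex EVx] := Em x.
by split; [apply: card_le_trans Ex _|apply: card_le_trans EVx _];
  rewrite card_le_II.
Qed.

Lemma EE_Fin2_sub k : in_2_omega k -> EE (Fin 2) `<=` EE k.
Proof.
case: k => [n /= n2 E [Ediag E2]|_ E [Ediag E2]|//].
  by split=> //; exact: n_bounded_leq n2 E2.
by split=> //; exists 2.
Qed.

Lemma EE_sub_Omega k : in_2_omega k -> EE k `<=` EE Omega.
Proof.
by case: k => [n _ E [Ediag En]|_ E|//]; first by split=> //; exists n.
Qed.

Lemma EE_Omega_sub_Omega1 : EE Omega `<=` EE Omega1.
Proof.
move=> E [Ediag [n En]]; split=> // x; have [Ex EVx] := En x.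
rewrite finite_setU.
by split; apply/finite_set_leP; exists n.
Qed.

(** * Covering a finitary entourage by finitely many involutions *)

Lemma card_le_II_seq (A : set nat) n : A #<= `I_n ->
  exists2 s : seq nat, size s = n & forall x, A x -> x \in s.
Proof.
move=> /pcard_leP[f].
have /choice[g gP] i : exists x, forall y, A y -> f y = i -> y = x.
  have [[x [Ax fx]]|nox] := pselect (exists x, A x /\ f x = i).
    exists x => y Ay fy; apply: (@inj _ _ _ f); [exact: mem_set..|].
    exact: etrans fy (esym fx).
  by exists 0 => y Ay fy; case: nox; exists y.
exists (map g (iota 0 n)); first by rewrite size_map size_iota.
move=> x Ax; rewrite (gP _ _ Ax erefl); apply/map_f; rewrite mem_iota.
exact: (@funS _ _ _ _ f).
Qed.

Lemma size_flatten_leq (T : Type) (ss : seq (seq T)) m :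
  all (fun s => size s <= m) ss -> size (flatten ss) <= size ss * m.
Proof.
elim: ss => //= s ss IHss /andP[sm /IHss].
by rewrite size_cat mulSn; exact: leq_add.
Qed.

Lemma fresh_exists (s : seq nat) : exists2 i, i <= size s & i \notin s.
Proof.
apply: contrapT => nos; have : size (iota 0 (size s).+1) <= size s.
  apply: uniq_leq_size; first exact: iota_uniq.
  move=> i; rewrite mem_iota /= add0n ltnS => is_.
  by apply/negPn/negP => ins; apply: nos; exists i.
by rewrite size_iota ltnn.
Qed.

(** N x lists the points whose colours x must avoid; only those below x matter
    when colours are attributed in increasing order. *)
Lemma greedy_colouring (N : nat -> seq nat) m :
  (forall x, size (N x) <= m) ->
  exists c : nat -> nat, (forall x, c x <= m) /\
    forall x y, y < x -> y \in N x -> c x <> c y.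
Proof.
move=> Nm.
have /choice[fresh freshP] s : exists i, i <= size s /\ i \notin s.
  by have [i] := fresh_exists s; exists i.
(* [col n] is the colouring of the points below n, with junk value 0 above. *)
pose col := fix col n x := if n is n'.+1 then
  if x == n' then fresh [seq col n' y | y <- N n'] else col n' x else 0.
pose c x := fresh [seq col x y | y <- N x].
have colc n x : x < n -> col n x = c x.
  elim: n => // n IHn; rewrite ltnS leq_eqVlt /=; case: eqVneq => [->//|_ /=].
  exact: IHn.
exists c; split=> [x|x y yx yN cxy].
  have [+ _] := freshP [seq col x y | y <- N x].
  by rewrite size_map => /leq_trans; exact.
have [_] := freshP [seq col x y | y <- N x]; rewrite -/(c x) cxy -(colc _ _ yx).
by rewrite map_f.
Qed.

(** A symmetric functional relation is a partial involution; it is completed by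
    the identity. *)
Lemma partial_involution (S : nat -> nat -> Prop) :
  (forall x y, S x y -> S y x) -> (forall x y z, S x y -> S x z -> y = z) ->
  exists2 h : nat -> nat, involutive h & forall x y, S x y -> h x = y.
Proof.
move=> Ssym Sfun.
have /choice[h hP] x : exists y, S x y \/ (forall z, ~ S x z) /\ y = x.
  have [[y Sxy]|noS] := pselect (exists y, S x y); first by exists y; left.
  by exists x; right; split=> // z Sxz; apply: noS; exists z.
have hE x y : S x y -> h x = y.
  by move=> Sxy; case: (hP x) => [/Sfun|[/(_ _ Sxy)//]]; exact.
exists h => // x; case: (hP x) => [/Ssym/hE//|[_ hx]]; by rewrite !hx.
Qed.

(** Let S be the composition of E with its inverse, and colour the points so
    that two distinct points joined by two S-steps have different colours.  Then
    a point has at most one S-neighbour of each colour, so that for each pair of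
    colours i, j the restriction of S to the pairs coloured by i and j is a
    partial involution, also when i = j. *)
Lemma finitary_cover E : finitary E -> exists C : set (nat -> nat),
  [/\ finite_set C, forall h, C h -> involutive h &
      forall x y z, E (x, z) -> E (y, z) -> exists2 h, C h & h x = y].
Proof.
move=> [n En].
have /choice[nb nbP] x : exists s : seq nat, size s <= n + n /\
    forall y, E (x, y) \/ E (y, x) -> y \in s.
  have [/card_le_II_seq[s sn sE] /card_le_II_seq[t tn tE]] := En x.
  exists (s ++ t); split; first by rewrite size_cat sn tn.
  move=> y Exy; rewrite mem_cat; apply/orP.
  by case: Exy => Exy; [left; apply: sE|right; apply: tE]; exact/xsectionP.
pose S x y := exists z, E (x, z) /\ E (y, z).
have Ssym x y : S x y -> S y x by move=> [z []]; exists z.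
pose next (N : nat -> seq nat) x := flatten [seq N z | z <- nb x].
have nextP N m : (forall x, size (N x) <= m) ->
    forall x, size (next N x) <= (n + n) * m.
  move=> Nm x; apply: (@leq_trans (size (nb x) * m)); last first.
    by rewrite leq_mul2r (nbP x).1 orbT.
  rewrite /next -(size_map N (nb x)); apply: size_flatten_leq.
  apply/allP => _ /mapP[z _ ->].
  exact: Nm.
have mem_next N x y z : E (x, y) \/ E (y, x) -> z \in N y -> z \in next N x.
  by move=> xy zy; apply/flatten_mapP; exists y => //; exact: (nbP x).2.
(* Two S-steps are four steps along E or its inverse. *)
have [m mP] : exists m, forall x, size (next (next (next nb)) x) <= m.
  by eexists; do 3!apply: (nextP) => //; move=> x; exact: (nbP x).1.
have [c [cM cP]] := greedy_colouring mP.
have {}cP x y z : S x y -> S y z -> c x = c z -> x = z.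
  wlog zx : x z / z < x => [hw|].
    move=> Sxy Syz cxz; have [xz|zx|//] := ltngtP x z; last exact: hw.
    by apply/esym/hw; rewrite ?cxz //; exact: Ssym.
  move=> [u [Exu Eyu]] [v [Eyv Ezv]] /cP []//.
  apply: (mem_next _ _ u); first by left.
  apply: (mem_next _ _ y); first by right.
  apply: (mem_next _ _ v); first by left.
  by apply: (nbP v).2; right.
pose T i j x y := S x y /\ ((c x = i /\ c y = j) \/ (c x = j /\ c y = i)).
have /choice[h hP] ij : exists h : nat -> nat, involutive h /\
    forall x y, T ij.1 ij.2 x y -> h x = y.
  have [||h hinv hT] := @partial_involution (T ij.1 ij.2); last by exists h.
  - move=> x y [Sxy cxy]; split; first exact: Ssym.
    by case: cxy => -[]; [right|left].
  - move=> x y z [/Ssym Syx cxy] [Sxz cxz]; apply: cP Syx Sxz _.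
    by case: cxy => -[cx ->]; case: cxz => -[cx' ->]; rewrite -?cx -?cx'.
exists (h @` (`I_m.+1 `*` `I_m.+1)); split.
- by apply: finite_image; apply: finite_setX; exact: finite_II.
- by move=> _ [ij _ <-]; have [] := hP ij.
move=> x y z Exz Eyz; exists (h (c x, c y)).
  by exists (c x, c y) => //; split; rewrite /= ltnS.
by apply: (hP (c x, c y)).2; split; [exists z|left].
Qed.

(** * Permutations and their graphs *)

Definition graph_entourage (h : nat -> nat) : set (nat * nat) :=
  [set p | p.2 = p.1 \/ p.2 = h p.1].

Lemma subset2_card_le T (A : set T) a b : A `<=` [set a; b] -> A #<= `I_2.
Proof.
move=> Aab.
apply: (@inj_fun_card_le _ _ _ _ (fun x => nat_of_bool `[< x = a >])).
  by move=> x _; case: `[< _ >].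
move=> x y /Aab xab /Aab yab.
case: asboolP => [->|nxa]; case: asboolP => [->|nya] //= _.
by case: xab => // ->; case: yab.
Qed.

Lemma graph_entourage_diag h : entourage (graph_entourage h).
Proof. by move=> [x y] xy; left; rewrite (xy : x = y). Qed.

Lemma graph_EE2 h : bijective h -> EE (Fin 2) (graph_entourage h).
Proof.
move=> [g hK gK]; split=> [|x]; first exact: graph_entourage_diag.
split.
  by apply: (@subset2_card_le _ _ x (h x)) => y /xsectionP.
apply: (@subset2_card_le _ _ x (g x)) => y /xsectionP[/= ->|/= ->].
  by left.
by right; rewrite hK.
Qed.

Lemma graph_EEo2 h : involutive h -> EEo (Fin 2) (graph_entourage h).
Proof.
move=> hK; split; first exact/graph_EE2/inv_bij.
split=> [x|x y [/= ->|/= ->]|x y z [/= ->|/= ->] [/= ->|/= ->]];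
  rewrite /graph_entourage /= ?hK; by [left|right].
Qed.

Definition Delta_perm_good (D : set nat) (h : nat -> nat) : Prop :=
  infinite_set [set a | [/\ D a, a <> h a & D (h a)]].

Definition Sigma_perm_good (AB : set nat * set nat) (h : nat -> nat) : Prop :=
  infinite_set (h @` AB.1 `&` AB.2).

Definition involutions : set (nat -> nat) := [set h | involutive h].

Lemma Delta_SE :
  Delta_S = mincard (dominating infinite_sets S_omega Delta_perm_good).
Proof. by []. Qed.

Lemma Sigma_SE :
  Sigma_S = mincard (dominating infinite_pairs S_omega Sigma_perm_good).
Proof.
congr mincard; apply/seteqP; split=> H [HS Hgood]; split=> //.
  by move=> [A B] [Ainf Binf]; exact: Hgood.
by move=> A B Ainf Binf; exact: (Hgood (A, B)).
Qed.

Lemma involutions_sub : involutions `<=` S_omega.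
Proof. by move=> h; exact: inv_bij. Qed.

(** Stated for any set H of functions, so that it applies both to all
    permutations and to involutions, whose graphs give the cellular families. *)
Lemma Delta_le_perm (Y : set (set (nat * nat))) (H : set (nat -> nat)) :
  (forall h, H h -> Y (graph_entourage h)) ->
  mincard_le (dominating infinite_sets Y Delta_good)
             (dominating infinite_sets H Delta_perm_good).
Proof.
move=> HY; apply: (@tukey_le _ _ _ _ _ _ _ _ _ _ eq) => [D Dinf|h /HY Yh].
  by exists D.
exists (graph_entourage h) => // D _ _ _ <-.
rewrite /Delta_good Delta_goodE; last exact: graph_entourage_diag.
apply: sub_infinite_set => x [Dx xh Dhx].
by split=> //; exists (h x); split=> //; [exact: nesym|right].
Qed.

Lemma Sigma_le_perm (Y : set (set (nat * nat))) (H : set (nat -> nat)) :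
  (forall h, H h -> Y (graph_entourage h)) ->
  mincard_le (dominating infinite_pairs Y Sigma_good)
             (dominating infinite_pairs H Sigma_perm_good).
Proof.
move=> HY; apply: (@tukey_le _ _ _ _ _ _ _ _ _ _ eq) => [AB ABinf|h /HY Yh].
  by exists AB.
exists (graph_entourage h) => // AB _ _ _ <-.
apply: sub_infinite_set => _ [[a Aa <-] Bha]; split.
  by exists a => //; apply/xsectionP; right.
by exists (h a) => //; apply/xsectionP; left.
Qed.

Lemma involutions_le_Delta :
  mincard_le (dominating infinite_sets involutions Delta_perm_good)
             (dominating infinite_sets (EE Omega) Delta_good).
Proof.
apply: (@tukey_le_countable _ _ _ _ _ _ _ _ _ _ eq).
- by move=> F; apply: Delta_dominating_infinite; exact: EE_Omega_sub_Omega1.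
- by move=> D Dinf; exists D.
move=> E [Ediag /finitary_cover[C [Cfin Cinv CE]]]; exists C; split=> //.
  exact: finite_set_countable.
move=> D _ _ _ <-; rewrite /Delta_good Delta_goodE // => Einf.
apply: contrapT => noC; apply: Einf.
apply: (@sub_finite_set _ _
    (\bigcup_(h in C) [set a | [/\ D a, a <> h a & D (h a)]])).
  move=> x [Dx [y [Dy yx Exy]]].
  have [h Ch hx] := CE _ _ _ Exy (Ediag (y, y) erefl).
  by exists h => //; split; rewrite ?hx //; exact: nesym.
apply: bigcup_finite => // h Ch; apply: contrapT => hinf.
by apply: noC; exists h.
Qed.

Lemma involutions_le_Sigma :
  mincard_le (dominating infinite_pairs involutions Sigma_perm_good)
             (dominating infinite_pairs (EE Omega) Sigma_good).
Proof.
apply: (@tukey_le_countable _ _ _ _ _ _ _ _ _ _ eq).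
- by move=> F; apply: Sigma_dominating_infinite; exact: EE_Omega_sub_Omega1.
- by move=> AB ABinf; exists AB.
move=> E EO; have [Ediag /finitary_cover[C [Cfin Cinv CE]]] := EO.
exists C; split=> //.
  exact: finite_set_countable.
have [_ Elf] := EE_Omega_sub_Omega1 EO.
move=> [A B] _ _ _ <- Einf; apply: contrapT => noC; apply: Einf => /=.
apply: (@sub_finite_set _ _
    (\bigcup_(h in C) \bigcup_(b in h @` A `&` B) xsection E b)).
  move=> z [[a Aa /xsectionP Eaz] [b Bb Ebz]].
  have [h Ch hab] := CE _ _ _ Eaz (iffLR (xsectionP _ _ _) Ebz).
  by exists h => //; exists b => //; split=> //; exists a.
apply: bigcup_finite => // h Ch; apply: bigcup_finite => [|b _].
  by apply: contrapT => hinf; apply: noC; exists h.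
exact: locally_finite_xsection.
Qed.

(** * The continuum *)

Lemma cardinal_cE :
  cardinal_c = mincard (dominating [set: nat -> bool] setT eq).
Proof.
apply/esym/mincardE; first by split=> // b _; exists b.
move=> B [_ Ball]; apply: subset_card_le => b _.
by have [//|b' Bb' ->] := Ball b.
Qed.

(** Retract omega onto L by a map that is injective outside L: its nonempty
    fibres consist of a point of L and at most one point outside L. *)
Lemma exists_cellular_hit (L : set nat) : infinite_set L ->
  exists2 E, EEo (Fin 2) E & Lambda_good L E.
Proof.
move=> /infinite_injseq[s sinj sL].
pose r x := if `[< L x >] then x else s x.
have rL x : L (r x) by rewrite /r; case: asboolP.
have rid x : L x -> r x = x by rewrite /r; case: asboolP.
pose E : set (nat * nat) := [set p | r p.1 = r p.2].
have Esym x y : E (x, y) -> E (y, x) by exact: esym.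
have E2 (A : set nat) x : (forall y, A y -> r y = r x) -> A #<= `I_2.
  move=> AE.
  apply: (@inj_fun_card_le _ _ _ _ (fun y => nat_of_bool `[< L y >])).
    by move=> y _; case: `[< _ >].
  move=> y z /AE yx /AE; rewrite -yx /r.
  case: asboolP => _; case: asboolP => _ //= + _.
  by move=> /sinj.
exists E.
  split; last by split=> [x|x y|x y z] //; exact: etrans.
  split=> [[x y] xy|x]; first by rewrite (xy : x = y).
  by split; apply: (E2 _ x) => y /xsectionP.
apply/seteqP; split=> // x _; exists (r x) => //; apply/xsectionP.
exact: (rid _ (rL x)).
Qed.

Lemma Lambda_le_c : mincard_le
  (dominating infinite_sets (EEo (Fin 2)) Lambda_good)
  (dominating [set: nat -> bool] setT eq).
Proof.
pose decode (b : nat -> bool) : set (nat * nat) := [set p | b (pickle p)].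
have [E0 E0in _] := exists_cellular_hit infinite_nat.
apply: (@tukey_le _ _ _ _ _ _ _ _ _ _
  (fun L b => EEo (Fin 2) (decode b) /\ Lambda_good L (decode b))).
  move=> L /exists_cellular_hit[E EF EL].
  pose b n := `[< exists2 p, E p & pickle p = n >].
  suff bE : decode b = E by exists b; rewrite ?bE.
  apply/seteqP; split=> p; last by move=> Ep; apply/asboolP; exists p.
  by move=> /asboolP[q Eq /(pcan_inj (@pickleK _)) <-].
move=> b _; have [bF|nbF] := pselect (EEo (Fin 2) (decode b)).
  by exists (decode b) => // L b' _ _ [_ Lb] <-.
by exists E0 => // L b' _ _ [bF _] bb'; case: nbF; rewrite -bb'.
Qed.

(** The branch of the binary tree through b, the nodes of the tree being encoded
    as natural numbers. *)
Definition branch (b : nat -> bool) : set nat :=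
  range (fun n => pickle (mkseq b n)).

Lemma branch_infinite b : infinite_set (branch b).
Proof.
apply: (@injseq_infinite _ _ (fun n => pickle (mkseq b n))) => [m n|n];
  last by exists n.
move=> /(pcan_inj (@pickleK _)) /(congr1 size).
by rewrite !size_mkseq.
Qed.

Lemma branch_almost_disjoint a b : a <> b -> finite_set (branch a `&` branch b).
Proof.
move=> ab; have [n abn] : exists n, a n <> b n.
  apply: contrapT => noab; apply: ab; apply: funext => n.
  by apply: contrapT => abn; apply: noab; exists n.
apply: (@sub_finite_set _ _ ((fun m => pickle (mkseq a m)) @` `I_n.+1));
  last first.
  exact/finite_image/finite_II.
move=> _ [[m _ <-] [m' _ /(pcan_inj (@pickleK _)) e]]; exists m => //=.
rewrite ltnNge; apply/negP => nm.
have mm' : m' = m by rewrite -[LHS](size_mkseq b) e size_mkseq.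
move: e; rewrite mm' => /(congr1 (fun s => nth true s n)).
by rewrite !nth_mkseq // => /esym.
Qed.

(** Given n+1 branches blown up to omega by an n-bounded E, choose x outside the
    E-image of their finite pairwise overlaps: the E-predecessors of x on these
    branches are then distinct. *)
Lemma Lambda_branch_finite E : EE Omega E ->
  finite_set [set b | Lambda_good (branch b) E].
Proof.
move=> EO; have [_ [n En]] := EO; have [_ Elf] := EE_Omega_sub_Omega1 EO.
apply: contrapT => /infinite_injseq[b binj bE].
pose W := \bigcup_(ij in [set ij : nat * nat |
    `I_n.+1 ij.1 /\ `I_n.+1 ij.2 /\ ij.1 <> ij.2])
  (branch (b ij.1) `&` branch (b ij.2)).
have Wfin : finite_set W.
  apply: bigcup_finite => [|[i j] [_ [_ ij]]]; last first.
    by apply: branch_almost_disjoint => /binj.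
  apply: (@sub_finite_set _ _ (`I_n.+1 `*` `I_n.+1)) => [[i j] [? [? _]]//|].
  by apply: finite_setX; exact: finite_II.
have [x xW] : exists x, ~ entourage_image E W x.
  apply: contrapT => nox; apply: infinite_nat.
  apply: (@sub_finite_set _ _ (entourage_image E W)).
    by move=> x _; apply: contrapT => xW; apply: nox; exists x.
  by apply: bigcup_finite => // w _; exact: locally_finite_xsection.
have /choice[l lP] i : exists l, branch (b i) l /\ E (l, x).
  have [l bl /xsectionP Elx] : entourage_image E (branch (b i)) x by rewrite bE.
  by exists l.
suff : `I_n.+1 #<= `I_n by rewrite card_le_II ltnn.
apply: card_le_trans (En x).2.
apply: (@inj_fun_card_le _ _ _ _ l) => [i _|i j iI jI lij].
  by apply/xsectionP; exact: (lP i).2.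
apply: contrapT => ij; apply: xW; exists (l i).
  2: by apply/xsectionP; exact: (lP i).2.
exists (i, j) => //; split; first exact: (lP i).1.
by rewrite lij; exact: (lP j).1.
Qed.

(** The branches serve as challenges, each E answering finitely many of them. *)
Lemma c_le_Lambda : mincard_le
  (dominating [set: nat -> bool] setT eq)
  (dominating infinite_sets (EE Omega) Lambda_good).
Proof.
apply: (@tukey_le_countable _ _ _ _ _ _ _ _ _ _ (fun b L => L = branch b)).
- move=> F [FO Flarge] Ffin.
  have : finite_set (\bigcup_(E in F) [set b | Lambda_good (branch b) E]).
    by apply: bigcup_finite => // E /FO; exact: Lambda_branch_finite.
  apply: (@injseq_infinite _ _ (fun m n => n == m)).
    by move=> m n /(congr1 (fun f => f m)); rewrite eqxx => /esym/eqP.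
  move=> m; have [E FE EL] := Flarge _ (@branch_infinite (fun n => n == m)).
  by exists E.
- by move=> b _; exists (branch b) => //; exact: branch_infinite.
move=> E EO; exists [set b | Lambda_good (branch b) E]; split=> //.
  exact/finite_set_countable/Lambda_branch_finite.
by move=> b L _ _ -> bE; exists b.
Qed.

(** * The theorem *)

(** All the families indexed by a cardinal between 2 and omega lie between the
    smallest one, the cellular entourages with cells of at most two points, and
    the largest one, all finitary entourages. *)
Lemma finitary_sandwich I U (X : set I) (R : I -> set (nat * nat) -> Prop)
    (P : set (set U)) k : in_2_omega k ->
  mincard_le (dominating X (EEo (Fin 2)) R) P ->
  mincard_le P (dominating X (EE Omega) R) ->
  mincard (dominating X (EE k) R) = mincard (dominating X (EEo k) R) /\
  mincard (dominating X (EEo k) R) = mincard P.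
Proof.
move=> k2 loP Phi.
have EEk_EEok : mincard_le (dominating X (EE k) R) (dominating X (EEo k) R).
  by apply: dominating_antitone => E [].
have P_EEk : mincard_le P (dominating X (EE k) R).
  apply: mincard_le_trans Phi _; apply: dominating_antitone.
  exact: EE_sub_Omega.
have EEok_P : mincard_le (dominating X (EEo k) R) P.
  apply: mincard_le_trans _ loP; apply: dominating_antitone => E [E2 Ecell].
  by split=> //; exact: EE_Fin2_sub E2.
split; apply: mincard_le_anti => //.
  exact: mincard_le_trans EEok_P P_EEk.
exact: mincard_le_trans P_EEk EEk_EEok.
Qed.

Theorem theorem4p2 :
  [/\ [/\ Delta (EE Omega1) = Delta (EEo Omega1),
          Delta (EEo Omega1) = Sigma (EE Omega1),
          Sigma (EE Omega1) = Sigma (EEo Omega1) &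
          Sigma (EEo Omega1) = cardinal_b],
      Lambda (EE Omega1) = Lambda (EEo Omega1) /\
      Lambda (EEo Omega1) = cardinal_d,
      forall k : cindex, in_2_omega k ->
        Lambda (EE k) = Lambda (EEo k) /\ Lambda (EEo k) = cardinal_c,
      forall k : cindex, in_2_omega k ->
        Delta (EE k) = Delta (EEo k) /\ Delta (EEo k) = Delta_S &
      forall k : cindex, in_2_omega k ->
        Sigma (EE k) = Sigma (EEo k) /\ Sigma (EEo k) = Sigma_S].
Proof.
have EEo1_sub : EEo Omega1 `<=` EE Omega1 by move=> E [].
have EE1_lf : EE Omega1 `<=` locally_finite by move=> E [].
have permO h : S_omega h -> EE Omega (graph_entourage h).
  by move=> /graph_EE2; exact: EE_Fin2_sub.
(* Both families are closed under composing E with its inverse, a cellular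
   entourage being unchanged. *)
have comp_EE1 E : EE Omega1 E -> exists2 E2, EE Omega1 E2 /\ entourage E2 &
    forall x y z, E (x, z) -> E (y, z) -> E2 (x, y).
  move=> [Ediag Elf].
  pose E2 : set (nat * nat) := [set p | exists z, E (p.1, z) /\ E (p.2, z)].
  have E2diag : entourage E2.
    by move=> [x y] xy; exists x; rewrite /= -(xy : x = y); split; exact: Ediag.
  exists E2; last by move=> x y z; exists z.
  split=> //; split=> // x.
  apply: (@sub_finite_set _ _ (\bigcup_(z in xsection E x) xsection E^-1 z)).
    by move=> y [] /xsectionP[z /= [? ?]]; exists z; apply/xsectionP.
  apply: bigcup_finite => [|z _]; first exact: locally_finite_xsection.
  exact: locally_finite_xsectionV.
have comp_EEo1 E : EEo Omega1 E -> exists2 E2, EEo Omega1 E2 /\ entourage E2 &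
    forall x y z, E (x, z) -> E (y, z) -> E2 (x, y).
  move=> Eo; have [[Ediag _] [_ Esym Etrans]] := Eo.
  exists E => // x y z Exz Eyz; exact: Etrans Exz (Esym _ _ Eyz).
split.
- rewrite !DeltaE !SigmaE cardinal_bE.
  have Delta_Deltao :=
    @dominating_antitone _ _ infinite_sets _ _ Delta_good EEo1_sub.
  have Sigma_Sigmao :=
    @dominating_antitone _ _ infinite_pairs _ _ Sigma_good EEo1_sub.
  have Delta_Sigma := Delta_le_Sigma EE1_lf comp_EE1.
  have Deltao_Sigmao := Delta_le_Sigma (subset_trans EEo1_sub EE1_lf) comp_EEo1.
  have Deltao_b := mincard_le_trans Deltao_Sigmao Sigma_le_b.
  have b_Deltao := mincard_le_trans b_le_Delta Delta_Deltao.
  have b_Sigma := mincard_le_trans b_le_Delta Delta_Sigma.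
  split; apply: mincard_le_anti => //.
  + exact: mincard_le_trans Deltao_b b_le_Delta.
  + exact: mincard_le_trans Deltao_b b_Sigma.
  + apply: mincard_le_trans Sigma_Sigmao _.
    exact: mincard_le_trans Sigma_le_b b_Deltao.
  + exact: mincard_le_trans Sigma_le_b b_Sigma.
  + exact: Sigma_le_b.
  + exact: mincard_le_trans b_Sigma Sigma_Sigmao.
- rewrite !LambdaE cardinal_dE.
  have EE_EEo :=
    @dominating_antitone _ _ infinite_sets _ _ Lambda_good EEo1_sub.
  split; apply: mincard_le_anti => //.
  + exact: mincard_le_trans Lambda_le_d d_le_Lambda.
  + exact: Lambda_le_d.
  + exact: mincard_le_trans d_le_Lambda EE_EEo.
- move=> k k2; rewrite !LambdaE cardinal_cE.
  exact: finitary_sandwich Lambda_le_c c_le_Lambda.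
- move=> k k2; rewrite !DeltaE Delta_SE; apply: finitary_sandwich => //.
    apply: mincard_le_trans (Delta_le_perm graph_EEo2) _.
    exact: mincard_le_trans involutions_le_Delta (Delta_le_perm permO).
  exact: mincard_le_trans (dominating_antitone involutions_sub)
    involutions_le_Delta.
- move=> k k2; rewrite !SigmaE Sigma_SE; apply: finitary_sandwich => //.
    apply: mincard_le_trans (Sigma_le_perm graph_EEo2) _.
    exact: mincard_le_trans involutions_le_Sigma (Sigma_le_perm permO).
  exact: mincard_le_trans (dominating_antitone involutions_sub)
    involutions_le_Sigma.
Qed.
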